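(* Let $(\phi_h^n,R_h^n)_{n\ge0}$ be generated by the first-order fully discrete PS-SAV scheme $$\frac{\phi_h^{n+1}-\phi_h^n}{\Delta t}=-M\mu_h^{n+1},$$ $$\mu_h^{n+1}=-s\epsilon^2(\Delta_h\phi_h^{n+1}-\Delta_h\phi_h^{n})+\frac{R_h^{n+1}}{E_h(\phi_h^n)+C}\left[-\epsilon^2\Delta_h\phi_h^{n}+F'(\phi_h^n)\right],$$ $$\frac{R_h^{n+1}-R_h^n}{\Delta t}=-\frac{1}{M}\left(\frac{\phi_h^{n+1}-\phi_h^n}{\Delta t},\frac{\phi_h^{n+1}-\phi_h^n}{\Delta t}\right)_m .$$ Given $R_h^0>0$, we have $R_h^n>0$ for all $n$, and for every $\Delta t>0$ (unconditional energy stability) $$R_h^{n+1}-R_h^{n}=-\frac{\Delta t}{M}\left(\frac{\phi_h^{n+1}-\phi_h^n}{\Delta t},\frac{\phi_h^{n+1}-\phi_h^n}{\Delta t}\right)_m\leq0 .$$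
   Context: $\Omega=(0,L)\times(0,L)$ with periodic boundary conditions, $h=L/N_{xy}$ with $N_{xy}$ a positive integer, grid points $(x_i,y_j)=(ih,jh)$, $1\le i,j\le N_{xy}$; grid functions $u=(u_{i,j})$ are extended periodically in both indices. $\Delta_hu_{i,j}=\frac{1}{h^2}(u_{i+1,j}+u_{i,j+1}+u_{i-1,j}+u_{i,j-1}-4u_{i,j})$; $(u,v)_m=h^2\sum_{i,j=1}^{N_{xy}}u_{i,j}v_{i,j}$. $\nabla_h^1u_{i+1/2,j}=(u_{i+1,j}-u_{i,j})/h$, $\nabla_h^2u_{i,j+1/2}=(u_{i,j+1}-u_{i,j})/h$, and $\|\nabla_hu\|_{TM}^2=h^2\sum_{i=0}^{N_{xy}-1}\sum_{j=1}^{N_{xy}}|\nabla_h^1u_{i+1/2,j}|^2+h^2\sum_{i=1}^{N_{xy}}\sum_{j=0}^{N_{xy}-1}|\nabla_h^2u_{i,j+1/2}|^2$. The discrete energy is $E_h(u)=\frac{\epsilon^2}{2}\|\nabla_hu\|_{TM}^2+(F(u),1)_m$, where $F$ is the nonlinear potential; $C>0$ is a constant such that $E_h(u)+C>0$; $M,\epsilon,s>0$ are constants ($s$ the stabilizing constant). ''Generated by the scheme'' means: given $\phi_h^n,R_h^n$, let $\phi_1$ solve $(E_h(\phi_h^n)+C)(I-Ms\epsilon^2\Delta t\Delta_h)\phi_1=-M[-\epsilon^2\Delta_h\phi_h^n+F'(\phi_h^n)]$; if $\phi_1=0$ set $\phi_h^{n+1}=\phi_h^n$, $R_h^{n+1}=R_h^n$;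 otherwise let $R_h^{n+1}=\dfrac{-\frac{M}{\Delta t}+\sqrt{\frac{M^2}{\Delta t^2}+4\frac{M}{\Delta t}R_h^n(\phi_1,\phi_1)_m}}{2(\phi_1,\phi_1)_m}$ and $\phi_h^{n+1}=\phi_h^n+\Delta t R_h^{n+1}\phi_1$. *)

(* Defs.v *)
From mathcomp Require Import all_boot all_order all_algebra.
From mathcomp Require Import all_classical all_reals all_analysis.
Import Order.TTheory GRing.Theory Num.Theory.
Import numFieldNormedType.Exports.

Set Implicit Arguments.
Unset Strict Implicit.
Unset Printing Implicit Defensive.

Local Open Scope ring_scope.

(* A periodic grid function is given by its N x N values on one period, as a
   matrix u : 'M[R]_N; the row index k : 'I_N stands for the residue class of
   i = k + 1, and likewise for columns. The periodic extension is built into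
   the cyclic shifts ordS (i |-> i + 1 mod N) and ord_pred (i |-> i - 1 mod N). *)

Definition mesh (R : realType) (L : R) (N : nat) : R := L / N%:R.

Definition laplacian (R : realType) (N : nat) (L : R) (u : 'M[R]_N) : 'M[R]_N :=
  \matrix_(i, j) ((mesh L N ^+ 2)^-1 *
    (u (ordS i) j + u i (ordS j) + u (ord_pred i) j + u i (ord_pred j)
     - 4%:R * u i j)).

Definition inner (R : realType) (N : nat) (L : R) (u v : 'M[R]_N) : R :=
  mesh L N ^+ 2 * \sum_(i < N) \sum_(j < N) u i j * v i j.

(* Values at the edge midpoints (i + 1/2, j) and (i, j + 1/2). *)
Definition grad1 (R : realType) (N : nat) (L : R) (u : 'M[R]_N) (i j : 'I_N) : R :=
  (u (ordS i) j - u i j) / mesh L N.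

Definition grad2 (R : realType) (N : nat) (L : R) (u : 'M[R]_N) (i j : 'I_N) : R :=
  (u i (ordS j) - u i j) / mesh L N.

(* The staggered index running over 0, ..., N - 1 meets each residue class
   mod N exactly once, so each sum ranges over all of 'I_N. *)
Definition normTM_sqr (R : realType) (N : nat) (L : R) (u : 'M[R]_N) : R :=
  mesh L N ^+ 2 * (\sum_(i < N) \sum_(j < N) `|grad1 L u i j| ^+ 2) +
  mesh L N ^+ 2 * (\sum_(i < N) \sum_(j < N) `|grad2 L u i j| ^+ 2).

Definition energy (R : realType) (N : nat) (L eps : R) (F : R -> R)
    (u : 'M[R]_N) : R :=
  eps ^+ 2 / 2%:R * normTM_sqr L u + inner L (map_mx F u) (const_mx 1).

(* One step (phi, r) |-> (phi', r') of the scheme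
     (phi' - phi) / dt = - M mu',
     mu' = - s eps^2 (lap phi' - lap phi)
           + r' / (E phi + C) (- eps^2 lap phi + F'(phi)),
     (r' - r) / dt = - (1 / M) ((phi' - phi) / dt, (phi' - phi) / dt).
   Eliminating mu' leaves phi' = phi + dt r' phi1 with phi1 as below, and the
   last equation becomes
     (phi1, phi1) r'^2 + (M / dt) r' - (M / dt) r = 0,
   of which the step takes the root with the + sign. *)
Definition ps_sav_step (R : realType) (N : nat) (L M eps s C : R) (F : R -> R)
    (dt : R) (phi : 'M[R]_N) (r : R) (phi' : 'M[R]_N) (r' : R) : Prop :=
  exists phi1 : 'M[R]_N,
    (energy L eps F phi + C) *:
      (phi1 - (M * s * eps ^+ 2 * dt) *: laplacian L phi1)
    = - (M *: (- (eps ^+ 2 *: laplacian L phi) + map_mx F^`()%classic phi)) /\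
    if phi1 == 0 then phi' = phi /\ r' = r
    else
      r' = (- (M / dt) +
             Num.sqrt (M ^+ 2 / dt ^+ 2 + 4%:R * (M / dt) * r * inner L phi1 phi1))
           / (2%:R * inner L phi1 phi1) /\
      phi' = phi + (dt * r') *: phi1.

Definition ps_sav_generated (R : realType) (N : nat) (L M eps s C : R)
    (F : R -> R) (dt : R) (phi : nat -> 'M[R]_N) (r : nat -> R) : Prop :=
  forall n : nat,
    ps_sav_step L M eps s C F dt (phi n) (r n) (phi n.+1) (r n.+1).

(* Main.v *)
Require Import Defs.
From mathcomp Require Import all_boot all_order all_algebra.
From mathcomp Require Import all_classical all_reals all_analysis.
From mathcomp Require Import ring.
Import Order.TTheory GRing.Theory Num.Theory.
Import numFieldNormedType.Exports.

Local Open Scope ring_scope.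

(* The scalar [r'] is the positive root of
   [(phi1, phi1) x^2 + (M / dt) x - (M / dt) r = 0]; since the constant
   coefficient is negative when [r > 0], positivity propagates, and the
   quadratic equation itself is the dissipation law because the difference
   quotient of [phi] equals [r' phi1]. *)

Lemma innerZ (R : realType) (N : nat) (L a : R) (u : 'M[R]_N) :
  inner L (a *: u) (a *: u) = a ^+ 2 * inner L u u.
Proof.
rewrite /inner mulrCA; congr (_ * _); rewrite mulr_sumr.
apply: eq_bigr => i _; rewrite mulr_sumr; apply: eq_bigr => j _.
by rewrite !mxE; ring.
Qed.

Lemma inner_ge0 (R : realType) (N : nat) (L : R) (u : 'M[R]_N) :
  0 <= inner L u u.
Proof.
apply: mulr_ge0; first exact: sqr_ge0.
by apply: sumr_ge0 => i _; apply: sumr_ge0 => j _; rewrite -expr2 sqr_ge0.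
Qed.

(** A vanishing sum of squares has vanishing terms, applied first to the rows and then within a row.
    This makes the denominator [2 * inner L phi1 phi1] of the scheme positive. *)
Lemma inner_gt0 (R : realType) (N : nat) (L : R) (u : 'M[R]_N) :
  0 < L -> u != 0 -> 0 < inner L u u.
Proof.
move=> L0 u0; rewrite lt0r inner_ge0 andbT; apply: contra u0 => /eqP uu0.
have row_ge0 i : 0 <= \sum_(j < N) u i j * u i j.
  by apply: sumr_ge0 => j _; rewrite -expr2 sqr_ge0.
apply/eqP/matrixP => i j; rewrite mxE.
(* The index [i] itself witnesses that the grid is nonempty, so the mesh size is nonzero. *)
have N0 : (0 < N)%N := leq_ltn_trans (leq0n i) (ltn_ord i).
have h0 : mesh L N ^+ 2 != 0 by rewrite expf_neq0 // gt_eqF // divr_gt0 // ltr0n.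
move/eqP: uu0; rewrite mulf_eq0 (negPf h0) /= => /eqP uu0.
have ui0 : \sum_(j < N) u i j * u i j = 0.
  exact: (psumr_eq0P (fun i _ => row_ge0 i) uu0).
have sq_ge0 k : true -> 0 <= u i k * u i k by rewrite -expr2 sqr_ge0.
by apply/eqP; rewrite -sqrf_eq0 expr2 (psumr_eq0P sq_ge0 ui0).
Qed.

(** The discriminant exceeds [m ^+ 2], so its square root exceeds [m]. Used with [P = (phi1, phi1)],
    [m = M / dt] and [c = r]. *)
Lemma positive_root (R : realType) (P m c : R) :
  0 < P -> 0 < m -> 0 < c ->
  let x := (- m + Num.sqrt (m ^+ 2 + 4%:R * m * c * P)) / (2%:R * P) in
  0 < x /\ P * x ^+ 2 + m * x = m * c.
Proof.
move=> P0 m0 c0 /=; set q := Num.sqrt _.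
have mcP : 0 < 4%:R * m * c * P by rewrite !mulr_gt0.
have qE : q ^+ 2 = m ^+ 2 + 4%:R * m * c * P.
  by rewrite sqr_sqrtr // addr_ge0 ?sqr_ge0 // ltW.
have mq : m < q.
  by rewrite -ltr_sqr ?nnegrE ?sqrtr_ge0 ?ltW // qE ltrDl.
split; first by rewrite divr_gt0 ?mulr_gt0 // addrC subr_gt0.
have Pn0 : P != 0 by rewrite gt_eqF.
(* Factor as [x * (P * x + m)], where [P * x + m = (q + m) / 2]: a difference of squares appears. *)
have -> : P * ((- m + q) / (2%:R * P)) ^+ 2 + m * ((- m + q) / (2%:R * P))
          = (q ^+ 2 - m ^+ 2) / (4%:R * P) by field.
by rewrite qE; field.
Qed.

Lemma ps_sav_step_dissipation (R : realType) (N : nat) (L M eps s C : R)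
    (F : R -> R) (dt : R) (phi phi' : 'M[R]_N) (r r' : R) :
  0 < L -> 0 < M -> 0 < dt -> 0 < r ->
  ps_sav_step L M eps s C F dt phi r phi' r' ->
  let d := dt^-1 *: (phi' - phi) in
  0 < r' /\ r' - r = - (dt / M) * inner L d d.
Proof.
move=> L0 M0 dt0 r0 [phi1 [_]] /=; case: eqVneq => [_ [-> ->]|phi1n0].
  (* Stationary case: the zero increment is written as [0 *: 0] so that [innerZ] makes its inner
     product vanish. *)
  by rewrite !subrr scaler0 -(scale0r (0 : 'M[R]_N)) innerZ expr0n /= mul0r mulr0.
rewrite -expr_div_n => -[r'E ->].
have [] := positive_root _ _ _ _ (inner_gt0 _ _ _ _ L0 phi1n0) (divr_gt0 M0 dt0) r0.
rewrite -r'E => r'0 quad; split=> //.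
have [Mn0 dtn0] : M != 0 /\ dt != 0 by rewrite !gt_eqF.
rewrite [phi + _]addrC addrK scalerA mulKf // innerZ [_ * inner _ _ _]mulrC.
(* The quadratic equation, solved for its leading term; the factor [- (dt / M)] then turns this into
   [r' - r]. *)
have -> : inner L phi1 phi1 * r' ^+ 2 = M / dt * r - M / dt * r'.
  by rewrite -quad addrK.
by field; rewrite Mn0 dtn0.
Qed.

Theorem theorem3p3 (R : realType) (N : nat) (L M eps s C : R) (F : R -> R)
    (dt : R) (phi : nat -> 'M[R]_N) (r : nat -> R)
    (hN : (0 < N)%N) (hL : 0 < L) (hM : 0 < M) (heps : 0 < eps) (hs : 0 < s)
    (hF : forall x : R, derivable F x 1)
    (hC : 0 < C) (hEC : forall u : 'M[R]_N, 0 < energy L eps F u + C)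
    (hdt : 0 < dt)
    (hgen : ps_sav_generated L M eps s C F dt phi r)
    (hr0 : 0 < r 0%N) :
  (forall n : nat, 0 < r n) /\
  (forall n : nat,
     let d := dt^-1 *: (phi n.+1 - phi n) in
     r n.+1 - r n = - (dt / M) * inner L d d /\
     - (dt / M) * inner L d d <= 0).
Proof.
(* Positivity comes first, by induction, since the dissipation law at each step presupposes
   [0 < r n]. *)
have rgt0 n : 0 < r n.
  elim: n => [//|n rn0].
  by have [] := ps_sav_step_dissipation _ _ _ _ _ _ _ _ _ _ _ _ _ hL hM hdt rn0 (hgen n).
split=> // n d; split.
  by have [] := ps_sav_step_dissipation _ _ _ _ _ _ _ _ _ _ _ _ _ hL hM hdt (rgt0 n) (hgen n).
by rewrite mulNr oppr_le0 mulr_ge0 ?inner_ge0 // ltW // divr_gt0.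
Qed.
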